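(* Let $R$ be the following set of $34$ residues modulo $9240$: $$R=\{1,\ 13^2,\ 17^2,\ 19^2,\ 23^2,\ 29^2,\ 31^2,\ 37^2,\ 41^2,\ 43^2,\ 13\cdot157,\ 47^2,\ 2521,\ 19\cdot 139,\ 2689,\ 53^2,\ 3361,\ 59^2,\ 3529,\ 61^2,\ 29\cdot149,\ 67^2,\ 71^2,\ 13\cdot 397,\ 73^2,\ 5569,\ 31\cdot 199,\ 79^2,\ 83^2,\ 7561,\ 7681,\ 89^2,\ 8089,\ 8761\}.$$ Then for every prime number $n$ whose residue modulo $9240$ does not lie in $R$, there exist positive integers $a\le b\le c$ with $\frac{4}{n}=\frac{1}{a}+\frac{1}{b}+\frac{1}{c}$. Moreover, for every $n\in\mathbb N$ whose residue modulo $9240$ does not lie in $R$: if $n\equiv 1201 \pmod{9240}$ then $n\in\mathcal C_8$; if $n\equiv 6001\pmod{9240}$ then $n\in\mathcal C_{40}$; and otherwise $n\in\mathcal C_3$.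
   Context: $\mathbb N$ denotes the positive integers. For $n\in\mathbb N$, a solution of $\frac{4}{n}=\frac{1}{a}+\frac{1}{b}+\frac{1}{c}$ means positive integers $a\le b\le c$ (not necessarily distinct) satisfying this equality. For $i\in\mathbb N$, $\mathcal C_i$ denotes the set of all $n\in\mathbb N$ for which this equation has a solution with $a\le \frac{n+4i-1}{4}$. *)

(* Defs.v *)
From Stdlib Require Import ZArith QArith Znumtheory List.
Import ListNotations.

(* The set N of positive integers is the type [positive], and [p # q] is the
   rational number p/q. *)

Definition is_solution (n a b c : positive) : Prop :=
  (a <= b)%positive /\ (b <= c)%positive /\
  (4 # n == (1 # a) + (1 # b) + (1 # c))%Q.

Definition C_class (i n : positive) : Prop :=
  exists a b c : positive,
    is_solution n a b c /\
    ((Zpos a # 1) <= (Zpos n + 4 * Zpos i - 1)%Z # 4)%Q.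

Definition exceptional_residues : list Z :=
  [1; 13^2; 17^2; 19^2; 23^2; 29^2; 31^2; 37^2; 41^2; 43^2; 13*157; 47^2;
   2521; 19*139; 2689; 53^2; 3361; 59^2; 3529; 61^2; 29*149; 67^2; 71^2;
   13*397; 73^2; 5569; 31*199; 79^2; 83^2; 7561; 7681; 89^2; 8089; 8761]%Z.

(* Main.v *)
(** Let [4 a = n + d].  If [x] and [y] divide [n a] and [x + y = d t], then
    [4/n - 1/a = d/(n a) = 1/(t n a / x) + 1/(t n a / y)].  For every residue
    [r] of [n] modulo 9240 outside the list, some [d] in {1, 2, 3, 4, 7, 11}
    (or [d = 31] for [r = 1201], [d = 159] for [r = 6001]) admits such [x] and
    [y] of the form [e] or [e n] with [e] a divisor of 2310: as [a] is
    determined modulo 2310 by [r], all the divisibility conditions depend on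
    [r] only, and they are verified by computation. *)

Require Import Defs.
From Stdlib Require Import ZArith QArith Znumtheory List.
From Stdlib Require Import Lia Bool.
Import ListNotations.

Lemma unit_fractions_sumE (n a b c : positive) :
  (4 # n == (1 # a) + (1 # b) + (1 # c))%Q <->
  (4 * (Zpos a * Zpos b * Zpos c) =
   Zpos n * (Zpos b * Zpos c + Zpos a * Zpos c + Zpos a * Zpos b))%Z.
Proof.
unfold Qeq; cbn [Qnum Qden Qplus]; rewrite !Pos2Z.inj_mul.
split; intros H; nia.
Qed.

(** The equation is symmetric in the denominators, and sorting never raises the first one, so an
    upper bound on [a] survives. *)
Lemma sorted_solution (n a b c : positive) :
  (4 # n == (1 # a) + (1 # b) + (1 # c))%Q ->
  exists a' b' c' : positive, is_solution n a' b' c' /\ (a' <= a)%positive.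
Proof.
rewrite unit_fractions_sumE; intros H.
assert (step : forall p q r : positive,
  (p <= q)%positive -> (q <= r)%positive -> (p <= a)%positive ->
  (4 * (Zpos p * Zpos q * Zpos r) =
   Zpos n * (Zpos q * Zpos r + Zpos p * Zpos r + Zpos p * Zpos q))%Z ->
  exists a' b' c' : positive, is_solution n a' b' c' /\ (a' <= a)%positive).
{ intros p q r pq qr pa E; exists p, q, r; unfold is_solution.
  rewrite unit_fractions_sumE; auto. }
destruct (Z.le_gt_cases (Zpos a) (Zpos b)); destruct (Z.le_gt_cases (Zpos b) (Zpos c));
  destruct (Z.le_gt_cases (Zpos a) (Zpos c));
  first [ apply (step a b c); lia | apply (step a c b); lia
        | apply (step b a c); lia | apply (step b c a); lia
        | apply (step c a b); lia | apply (step c b a); lia ].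
Qed.

Lemma C_class_of_divisors (i n : positive) (a d x y : Z) :
  (0 < a -> 0 < d <= 4 * Zpos i - 1 -> 4 * a = Zpos n + d ->
   0 < x -> 0 < y -> (x | Zpos n * a) -> (y | Zpos n * a) -> (d | x + y) ->
   C_class i n)%Z.
Proof.
intros a0 [d0 di] Ea x0 y0 [u Eu] [v Ev] [t Et].
assert (u0 : (0 < u)%Z) by nia.
assert (v0 : (0 < v)%Z) by nia.
assert (t0 : (0 < t)%Z) by nia.
(* Since [u * x = v * y = n * a], the denominators [t * u] and [t * v] give
   [(x + y) / (t * n * a) = d / (n * a)]. *)
assert (sum : (4 * (a * (t * u) * (t * v)) =
  Zpos n * ((t * u) * (t * v) + a * (t * v) + a * (t * u)))%Z).
(* The factor [x * y] completes [u] and [v] to [u * x] and [v * y], both equal to [n * a]. *)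
{ apply (Z.mul_reg_r _ _ (x * y)); [nia |].
  transitivity (4 * a * (t * t) * ((u * x) * (v * y)))%Z; [ring |].
  transitivity (Zpos n * (t * t * ((u * x) * (v * y))
    + a * t * (x * (v * y) + y * (u * x))))%Z; [| ring].
  rewrite <- Eu, <- Ev, Ea.
  transitivity ((Zpos n + d) * (t * t) * (Zpos n * a * (Zpos n * a)))%Z;
    [ring |].
  transitivity (Zpos n * (t * t * (Zpos n * a * (Zpos n * a))
    + a * t * ((x + y) * (Zpos n * a))))%Z; [rewrite Et |]; ring. }
destruct (sorted_solution n (Z.to_pos a) (Z.to_pos (t * u)) (Z.to_pos (t * v)))
  as (p & q & r & sol & pa).
{ rewrite unit_fractions_sumE, !Z2Pos.id by nia; exact sum. }
exists p, q, r; split; [exact sol |].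
unfold Qle; cbn [Qnum Qden]; lia.
Qed.

Open Scope Z_scope.

(** A quadruple [(d, x, f, k)] stands for the witnesses [d], [x] and
    [y = f] (if [k] is [false]) or [y = f * n] (if [k] is [true]). *)
Definition valid (r : Z) (w : Z * Z * Z * bool) : bool :=
  let '(d, x, f, k) := w in
  let a := (r + d) / 4 in
  ((r + d) mod 4 =? 0) && (2310 mod x =? 0) && (2310 mod f =? 0) &&
  (r * a mod x =? 0) &&
  if k then (9240 mod d =? 0) && (a mod f =? 0) && ((x + f * r) mod d =? 0)
  else (r * a mod f =? 0) && ((x + f) mod d =? 0).

(** Passing from [r] to [n] adds [9240 * q] to the residue and [2310 * q] to [a], which preserves
    divisibility by divisors of 2310. For [y = f * n] the sum [x + y] also moves, by a multiple of
    9240, hence the test that [d] divides 9240; for [y = f] it is constant and any [d] is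
    allowed. *)
Lemma C_class_of_valid (i n : positive) (d x f : Z) (k : bool) :
  0 < d <= 4 * Zpos i - 1 -> 0 < x -> 0 < f ->
  valid (Zpos n mod 9240) (d, x, f, k) = true -> C_class i n.
Proof.
intros di x0 f0; unfold valid.
set (r := Zpos n mod 9240); set (a := (r + d) / 4); set (q := Zpos n / 9240).
assert (En : Zpos n = 9240 * q + r) by (apply Z.div_mod; lia).
rewrite !andb_true_iff, !Z.eqb_eq; intros [[[[Hr Hx] Hf] Hxa] Hk].
assert (Ea : r + d = 4 * a) by (apply Z.div_exact; [lia | exact Hr]).
set (b := 2310 * q + a).
assert (Eb : 4 * b = Zpos n + d) by lia.
assert (na : forall z, (z | 2310) -> (z | r * a) -> (z | Zpos n * b)).
{ intros z [s Es] [m Em]; exists (s * (9240 * q * q + 4 * q * a + r * q) + m).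
  transitivity (2310 * (9240 * q * q + 4 * q * a + r * q) + r * a);
    [unfold b; lia |].
  rewrite Es, Em; ring. }
apply Z.mod_divide in Hx; [| lia]; apply Z.mod_divide in Hf; [| lia].
apply Z.mod_divide in Hxa; [| lia].
destruct k; rewrite !andb_true_iff, !Z.eqb_eq in Hk.
- destruct Hk as [[Hd Hfa] Hs].
  apply Z.mod_divide in Hd; [| lia]; apply Z.mod_divide in Hfa; [| lia].
  apply Z.mod_divide in Hs; [| lia].
  apply (C_class_of_divisors i n b d x (f * Zpos n)); auto; try lia.
  + rewrite Z.mul_comm; apply Z.mul_divide_mono_l.
    apply Z.divide_add_r; [apply Z.divide_mul_l |]; assumption.
  + replace (x + f * Zpos n) with (9240 * (f * q) + (x + f * r))
      by (rewrite En; ring).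
    apply Z.divide_add_r; [apply Z.divide_mul_l |]; assumption.
- destruct Hk as [Hfa Hs].
  apply Z.mod_divide in Hfa; [| lia]; apply Z.mod_divide in Hs; [| lia].
  apply (C_class_of_divisors i n b d x f); auto; lia.
Qed.

(** The first three entries settle all residues other than 1 modulo 4; the others have [d] equal to
    3, 7 or 11. The largest, 11, is [4 * 3 - 1], the bound for class 3. *)
Definition witnesses : list (Z * Z * Z * bool) :=
  [(1, 1, 1, false); (2, 2, 2, false); (4, 2, 2, false);
   (3, 3, 3, false); (3, 1, 1, true); (3, 1, 2, false); (3, 1, 5, false);
   (3, 1, 11, false);
   (7, 7, 7, false); (7, 1, 1, true); (7, 1, 2, true); (7, 2, 1, true);
   (7, 2, 5, false);
   (11, 1, 1, true); (11, 1, 3, true); (11, 1, 5, true); (11, 5, 1, true)].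

Lemma witnesses_cover (r : Z) :
  0 <= r < 9240 -> ~ In r exceptional_residues -> r <> 1201 -> r <> 6001 ->
  existsb (valid r) witnesses = true.
Proof.
intros rb nex n1201 n6001.
(* Listing the excluded residues as an alternative makes this a closed check over all 9240
   residues. *)
assert (all : forallb (fun s => existsb (valid s) witnesses
    || existsb (Z.eqb s) (1201 :: 6001 :: exceptional_residues))
  (map Z.of_nat (seq 0 (Z.to_nat 9240))) = true) by (vm_compute; reflexivity).
rewrite forallb_forall in all.
assert (inr : In r (map Z.of_nat (seq 0 (Z.to_nat 9240)))).
{ apply in_map_iff; exists (Z.to_nat r); rewrite in_seq; lia. }
apply all, orb_true_iff in inr; destruct inr as [| inr]; [assumption |].
apply existsb_exists in inr; destruct inr as (s & ins & Es).
apply Z.eqb_eq in Es; subst s.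
destruct ins as [E | [E | ins]]; [| | contradiction]; congruence.
Qed.

Close Scope Z_scope.

Theorem theorem2p2 :
  (forall n : positive,
     prime (Zpos n) ->
     ~ In (Zpos n mod 9240)%Z exceptional_residues ->
     exists a b c : positive, is_solution n a b c)
  /\
  (forall n : positive,
     ~ In (Zpos n mod 9240)%Z exceptional_residues ->
     ((Zpos n mod 9240 = 1201)%Z -> C_class 8 n) /\
     ((Zpos n mod 9240 = 6001)%Z -> C_class 40 n) /\
     ((Zpos n mod 9240 <> 1201)%Z -> (Zpos n mod 9240 <> 6001)%Z ->
      C_class 3 n)).
Proof.
assert (classes : forall n : positive,
  ~ In (Zpos n mod 9240)%Z exceptional_residues ->
  ((Zpos n mod 9240 = 1201)%Z -> C_class 8 n) /\
  ((Zpos n mod 9240 = 6001)%Z -> C_class 40 n) /\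
  ((Zpos n mod 9240 <> 1201)%Z -> (Zpos n mod 9240 <> 6001)%Z ->
   C_class 3 n)).
{ intros n nex; split; [| split].
  (* Here [31 = 4 * 8 - 1], [a = 308 = 2 * 154] and [1 + 154 = 5 * 31]. *)
  - intros E; apply (C_class_of_valid 8 n 31 1 154 false); try lia.
    rewrite E; reflexivity.
  (* Here [159 = 4 * 40 - 1 = 5 + 154], and [a = 1540] is a multiple of 5 and of 154. *)
  - intros E; apply (C_class_of_valid 40 n 159 5 154 false); try lia.
    rewrite E; reflexivity.
  - intros n1201 n6001.
    assert (cover : existsb (valid (Zpos n mod 9240)) witnesses = true).
    { apply witnesses_cover; auto; apply Z.mod_pos_bound; lia. }
    apply existsb_exists in cover; destruct cover as ([[[d x] f] k] & inw & ok).
    assert (bounds : (0 < d <= 11 /\ 0 < x /\ 0 < f)%Z).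
    { unfold witnesses in inw; simpl in inw.
      repeat destruct inw as [[= <- <- <- <-] | inw]; try lia; contradiction. }
    apply (C_class_of_valid 3 n d x f k); auto; lia. }
split; [| exact classes].
intros n _ nex; destruct (classes n nex) as (c8 & c40 & c3).
destruct (Z.eq_dec (Zpos n mod 9240) 1201) as [E1 | E1];
  [| destruct (Z.eq_dec (Zpos n mod 9240) 6001) as [E2 | E2]].
- destruct (c8 E1) as (a & b & c & sol & _); exists a, b, c; exact sol.
- destruct (c40 E2) as (a & b & c & sol & _); exists a, b, c; exact sol.
- destruct (c3 E1 E2) as (a & b & c & sol & _); exists a, b, c; exact sol.
Qed.
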